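(* There exist universal constants $0<c_1\le c_2<\infty$ such that for every dimension $d\ge 1$, every radius $r>0$, every $n\ge 1$ and every $\boldsymbol\lambda\in[0,1]^n$, \[ c_1\, r^2 f(\boldsymbol\lambda,1)\;\le\; L(\boldsymbol\lambda,\mathcal D^b_r)\;\le\; c_2\, r^2 f(\boldsymbol\lambda,1), \qquad f(\boldsymbol\lambda,k)=\min_{t\in[0,1]}\Big(\frac{k}{|\{i:\lambda_i\le t\}|}+t^2\Big). \]
   Context: $\boldsymbol\lambda$-contamination: given $\boldsymbol\lambda=(\lambda_1,\dots,\lambda_n)\in[0,1]^n$ and a distribution $P$ on $\mathbb R^d$, a dataset $\mathbf Z=(Z_1,\dots,Z_n)$ is generated as $Z_i=(1-B_i)X_i+B_i\tilde X_i$, where $X_1,\dots,X_n$ are i.i.d. from $P$, $B_i\sim\mathrm{Bernoulli}(\lambda_i)$ are independent (and independent of the $X_i$), and the outliers $(\tilde X_1,\dots,\tilde X_n)$ are drawn from an arbitrary joint distribution (the ''adversary'') that may depend on the realizations of $X_1,\dots,X_n$ and $B_1,\dots,B_n$. Write $\mathbf Z\sim_{\boldsymbol\lambda}P$. For a class $\mathcal D$ of distributions with means $\mu_P=\mathbb E_{X\sim P}[X]$, the minimax rate is $L(\boldsymbol\lambda,\mathcal D)=\inf_M\sup\mathbb E\|M(\mathbf Z)-\mu_P\|_2^2$, where the infimum is over all estimators $M$ (measurable functions of $\mathbf Z$, which may use knowledge of $\boldsymbol\lambda$) and the supremum is over $P\in\mathcal D$ and over all adversaries. $\mathcal D^b_r$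 is the set of all distributions on $\mathbb R^d$ supported on the closed Euclidean ball of radius $r$ centered at the origin. In $f$, the convention $k/0=+\infty$ is used. *)

(* Defs.v *)
From HB Require Import structures.
From mathcomp Require Import all_boot all_order all_algebra.
From mathcomp Require Import all_classical all_reals all_analysis.

Set Implicit Arguments.
Unset Strict Implicit.
Unset Printing Implicit Defensive.

Import Order.TTheory GRing.Theory Num.Theory.
Import numFieldNormedType.Exports.

Local Open Scope classical_set_scope.
Local Open Scope ring_scope.

Section Defs.
Variable R : realType.

(** Points of R^d are d-tuples of reals; d.-tuple R carries the product
    (coordinate-generated = Borel) sigma-algebra of mathcomp-analysis. *)
Definition vec (d : nat) := (d.-tuple R).

Definition sqnorm (d : nat) (v : vec d) : R := \sum_(i < d) (tnth v i) ^+ 2.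

Definition mean (d : nat) (P : probability (vec d) R) : vec d :=
  [tuple Rintegral P setT (fun x : vec d => tnth x i) | i < d].

Definition ball_class (d : nat) (r : R) : set (probability (vec d) R) :=
  [set P | P [set x : vec d | sqnorm x <= r ^+ 2] = 1%E].

(** Expectation of g : (R^d)^n -> [0,+oo] under the product law P^{(x) n},
    written as an iterated integral (equal to the product-measure integral
    for nonnegative measurable g, by Tonelli). *)
Fixpoint iter_int (d : nat) (P : probability (vec d) R) (n : nat)
  : (n.-tuple (vec d) -> \bar R) -> \bar R :=
  match n with
  | 0 => fun g => g [tuple]
  | m.+1 => fun g =>
      (\int[P]_(x in setT) iter_int P (fun t : m.-tuple (vec d) => g [tuple of x :: t]))%E
  end.

Definition bern_weight (n : nat) (lam : 'I_n -> R) (b : n.-tuple bool) : R :=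
  \prod_(i < n) (if tnth b i then lam i else 1 - lam i).

Definition contaminate (d n : nat) (x : n.-tuple (vec d)) (b : n.-tuple bool)
  (xt : n.-tuple (vec d)) : n.-tuple (vec d) :=
  [tuple if tnth b i then tnth xt i else tnth x i | i < n].

(** An adversary: the joint law of the outliers (Xtilde_1..Xtilde_n) given the
    realizations of X = (X_1..X_n) and B = (B_1..B_n), i.e. a probability kernel
    from (X, B) to (R^d)^n (B ranges over a finite discrete set, so a family of
    kernels indexed by b is exactly a kernel from the pair (X,B)). *)
Definition adversary (d n : nat) :=
  n.-tuple bool -> R.-pker (n.-tuple (vec d)) ~> (n.-tuple (vec d)).

Definition risk (d n : nat) (lam : 'I_n -> R)
  (M : n.-tuple (vec d) -> vec d) (P : probability (vec d) R)
  (A : adversary d n) : \bar R :=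
  (\sum_(b : n.-tuple bool)
     (bern_weight lam b)%:E *
     iter_int P (fun x : n.-tuple (vec d) =>
       \int[A b x]_(xt in setT)
          (sqnorm [tuple tnth (M (contaminate x b xt)) i - tnth (mean P) i | i < d])%:E))%E.

Definition estimators (d n : nat) : set (n.-tuple (vec d) -> vec d) :=
  [set M | measurable_fun setT M].

Definition minimax_rate (d n : nat) (lam : 'I_n -> R) (r : R) : \bar R :=
  ereal_inf [set ereal_sup [set risk lam M P A | P in @ball_class d r & A in [set: @adversary d n]]
            | M in @estimators d n].

Definition fval (n : nat) (lam : 'I_n -> R) (k : R) (t : R) : \bar R :=
  let N := #|[set i : 'I_n | lam i <= t]| in
  ((if N == 0%N then +oo else (k / N%:R)%:E) + (t ^+ 2)%:E)%E.

Definition frate (n : nat) (lam : 'I_n -> R) (k : R) : \bar R :=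
  ereal_inf [set fval lam k t | t in `[0, 1]].

End Defs.

(* Main.v *)
Require Import Defs.
From HB Require Import structures.
From mathcomp Require Import all_boot all_order all_algebra.
From mathcomp Require Import all_classical all_reals all_analysis.
From mathcomp Require Import measurable_realfun ring lra.
Set Implicit Arguments.
Unset Strict Implicit.
Unset Printing Implicit Defensive.
Import Order.TTheory GRing.Theory Num.Theory.
Local Open Scope classical_set_scope.
Local Open Scope ring_scope.

(** Upper bound: average, over the [N] indices with [lam i <= t], the data
    clipped to the ball of radius [r].  The sampling error is at most [r^2/N];
    the contamination moves the average by at most [2 r] times the fraction of
    contaminated indices, whose second moment is at most [t^2 + 1/N].

    Lower bound: for a scale [th], compare the two laws on [{r e, - r e}] with
    means [th r e] and [- th r e].  Where [th <= lam i], the adversary can make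
    [Z_i] exactly symmetric, so only the indices with [lam i < th] carry
    information, and the hypotheses cannot be told apart when there are at most
    [1 / (4 th^2)] of them (Le Cam).  The largest dyadic [th] with this property
    satisfies [f <= 20 th^2]: its double violates it, so at least
    [1 / (16 th^2)] indices have [lam i <= 2 th]. *)

(** * The lower bound *)

Section TupleSums.

Lemma reindex_cons_tuple (S : nmodType) (I : finType) (n : nat)
    (F : n.+1.-tuple I -> S) :
  \sum_(t : n.+1.-tuple I) F t = \sum_(e : I) \sum_(t : n.-tuple I) F [tuple of e :: t].
Proof.
rewrite pair_bigA /= (reindex (fun p : I * n.-tuple I => [tuple of p.1 :: p.2])) //.
exists (fun t : n.+1.-tuple I => (thead t, [tuple of behead t])) => [[e t] _|t _] /=.
  by congr pair; apply: val_inj.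
by rewrite [RHS](tuple_eta t).
Qed.

(** Factors sums against a product law into one-coordinate sums, by carrying distributivity from
    finite functions over to tuples. *)
Lemma prod_sum_tuple (S : comPzSemiRingType) (I : finType) (n : nat)
    (F : 'I_n -> I -> S) :
  \sum_(t : n.-tuple I) \prod_(i < n) F i (tnth t i) = \prod_(i < n) \sum_(e : I) F i e.
Proof.
rewrite bigA_distr_bigA (reindex (fun t : n.-tuple I => [ffun i => tnth t i])) /=.
  by apply: eq_bigr => t _; apply: eq_bigr => i _; rewrite ffunE.
exists (fun f : {ffun 'I_n -> I} => [tuple f i | i < n]) => [t _|f _].
  by apply: eq_from_tnth => i; rewrite tnth_mktuple ffunE.
by apply/ffunP => i; rewrite ffunE tnth_mktuple.
Qed.

(** Lets the indicator of an outcome be absorbed into a product over coordinates. *)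
Lemma natr_eq_tuple (S : comPzSemiRingType) (I : eqType) n (s t : n.-tuple I) :
  (s == t)%:R = \prod_(i < n) (tnth s i == tnth t i)%:R :> S.
Proof.
have [<-|st] := eqVneq s t; first by rewrite big1 // => i _; rewrite eqxx.
have /forallPn[i /negbTE sti] : ~~ [forall i, tnth s i == tnth t i].
  by apply: contra st => /forallP st; apply/eqP/eq_from_tnth => i; exact/eqP.
by rewrite (bigD1 i) //= sti mul0r.
Qed.

End TupleSums.

(** * Finitely supported probability laws *)

Section FiniteMixture.
Local Open Scope ereal_scope.
Context d (T : measurableType d) (R : realType) (I : finType).
Variables (w : I -> R) (pt : I -> T).
Hypothesis w0 : forall i, (0 <= w i)%R.

(** [msum] runs over natural numbers, so an index is decoded through [insub] and [enum_val]; numbers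
    out of range get the zero measure. *)
Definition mixture_part (k : nat) : {measure set T -> \bar R} :=
  if insub k is Some i then mscale (NngNum (w0 (enum_val (i : 'I_#|I|)))) (\d_(pt (enum_val i)))
  else mzero.

Definition mixture : set T -> \bar R := msum mixture_part #|I|.

HB.instance Definition _ := Measure.on mixture.

Lemma ge0_integral_mixture (f : T -> \bar R) : measurable_fun setT f ->
  (forall x, 0 <= f x) -> \int[mixture]_x f x = \sum_(i : I) (w i)%:E * f (pt i).
Proof.
move=> mf f0; rewrite ge0_integral_measure_sum // (reindex (@enum_val I (mem I))) /=; last first.
  by apply: onW_bij; exact: enum_val_bij.
apply: eq_bigr => i _; rewrite /mixture_part valK ge0_integral_mscale //.
by rewrite integral_dirac // diracT mul1e.
Qed.

Hypothesis w1 : (\sum_i w i = 1)%R.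

Let mixture_setT : mixture setT = 1.
Proof.
rewrite -[LHS]mul1e -integral_cst // ge0_integral_mixture //.
by under eq_bigr do rewrite mule1; rewrite sumEFin w1.
Qed.

HB.instance Definition _ := Measure_isProbability.Build _ _ _ mixture mixture_setT.

Definition mixture_probability : probability T R := mixture.

(** The positive and negative parts of [f] both have finite sums, so the nonnegative case applies to
    each and the difference recombines termwise. *)
Lemma integral_mixture_EFin (f : T -> R) : measurable_fun setT f ->
  \int[mixture]_x (f x)%:E = (\sum_(i : I) w i * f (pt i))%R%:E.
Proof.
move=> mf; rewrite integralE !ge0_integral_mixture //; last 2 first.
- by apply: measurable_funeneg; exact/measurable_EFinP.
- by apply: measurable_funepos; exact/measurable_EFinP.
under eq_bigr do rewrite funeposE -EFin_max -EFinM.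
under [X in _ - X]eq_bigr do rewrite funenegE -EFinN -EFin_max -EFinM.
rewrite !sumEFin -EFinB -sumrB; congr EFin; apply: eq_bigr => i _.
rewrite -mulrBr; congr (_ * _)%R.
rewrite !maxEle; case: ifPn; case: ifPn; lra.
Qed.

End FiniteMixture.

(** * Contamination at the level of bits *)

Definition mix n (x b y : n.-tuple bool) : n.-tuple bool :=
  [tuple if tnth b i then tnth y i else tnth x i | i < n].

(** Flags, clean values and outliers all have product weights, so the mixed tuple does too: its
    weight at one coordinate comes from summing out the flag and the discarded value. *)
Lemma sum_mix (S : comPzSemiRingType) n (w p q : 'I_n -> bool -> S)
    (G : n.-tuple bool -> S) :
  \sum_(b : n.-tuple bool) (\prod_(i < n) w i (tnth b i)) *
    (\sum_(x : n.-tuple bool) (\prod_(i < n) p i (tnth x i)) *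
      (\sum_(y : n.-tuple bool) (\prod_(i < n) q i (tnth y i)) * G (mix x b y))) =
  \sum_(z : n.-tuple bool) (\prod_(i < n) (w i false * p i (tnth z i) * (\sum_e q i e) +
      w i true * (\sum_e p i e) * q i (tnth z i))) * G z.
Proof.
(* Joint weight at one coordinate of flag [e], clean value [c] and outlier [f], restricted to the
   event that the observed value is [g]. *)
pose K i (e c f g : bool) : S := w i e * (p i c * (q i f * ((if e then f else c) == g)%:R)).
transitivity (\sum_(z : n.-tuple bool) (\sum_(b : n.-tuple bool)
    \sum_(x : n.-tuple bool) \sum_(y : n.-tuple bool)
    \prod_(i < n) K i (tnth b i) (tnth x i) (tnth y i) (tnth z i)) * G z).
  under [RHS]eq_bigr do rewrite mulr_suml.
  rewrite exchange_big /=; apply: eq_bigr => b _.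
  under [RHS]eq_bigr do rewrite mulr_suml.
  rewrite exchange_big /= mulr_sumr; apply: eq_bigr => x _.
  under [RHS]eq_bigr do rewrite mulr_suml.
  rewrite exchange_big /= !mulr_sumr; apply: eq_bigr => y _.
  rewrite [RHS](bigD1 (mix x b y)) //= [X in _ + X]big1 ?addr0 => [|z zm].
    rewrite !mulrA -!big_split /=; congr (_ * _); apply: eq_bigr => i _.
    by rewrite /K tnth_mktuple eqxx mulr1 mulrA.
  rewrite !big_split /= -[X in _ * (_ * (_ * X))](_ : (mix x b y == z)%:R = _).
    by rewrite eq_sym (negbTE zm) !mulr0 mul0r.
  by rewrite natr_eq_tuple; apply: eq_bigr => i _; rewrite tnth_mktuple.
apply: eq_bigr => z _; congr (_ * _).
under eq_bigr do under eq_bigr do rewrite (prod_sum_tuple (fun i f => K i _ _ f _)).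
under eq_bigr do rewrite (prod_sum_tuple (fun i c => \sum_e K i _ c e _)).
rewrite (prod_sum_tuple (fun i b => \sum_c \sum_e K i b c e _)).
apply: eq_bigr => i _; rewrite !big_bool /K /=.
case: (tnth z i) => /=; ring.
Qed.

(** * Le Cam's two-point bound for product laws on signs *)

Section LeCam.
Variable R : realType.

(** The mass at [b] of the law on [{1, -1}] (coded by [bool]) with mean [m]. *)
Definition sign_weight (m : R) (b : bool) : R := (1 + (if b then m else - m)) / 2.

Lemma sign_weight_sum m : \sum_b sign_weight m b = 1.
Proof. by rewrite big_bool /sign_weight /=; field. Qed.

Lemma sign_weight_ge0 m b : `|m| <= 1 -> 0 <= sign_weight m b.
Proof. by rewrite ler_norml /sign_weight => /andP[? ?]; case: b; lra. Qed.

(** Weierstrass' product inequality; the induction discards a nonnegative cross term. *)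
Lemma prod_1subr_ge (n : nat) (a : 'I_n -> R) : (forall i, 0 <= a i <= 1) ->
  1 - \sum_i a i <= \prod_i (1 - a i).
Proof.
elim: n a => [|n ih] a a01; first by rewrite !big_ord0 subr0.
rewrite !big_ord_recl.
have := ih (fun i => a (lift ord0 i)) (fun i => a01 _).
have s0 : 0 <= \sum_(i < n) a (lift ord0 i).
  by apply: sumr_ge0 => i _; case/andP: (a01 (lift ord0 i)).
case/andP: (a01 ord0); nra.
Qed.

Lemma le_cam_two_point n (eta : 'I_n -> R) (h : n.-tuple bool -> R) (a : R) :
  (forall i, 0 <= eta i <= 1) -> \sum_i eta i ^+ 2 <= 4^-1 ->
  a ^+ 2 / 2 <=
    \sum_(z : n.-tuple bool) (\prod_(i < n) sign_weight (eta i) (tnth z i)) * (h z - a) ^+ 2 +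
    \sum_(z : n.-tuple bool) (\prod_(i < n) sign_weight (- eta i) (tnth z i)) * (h z + a) ^+ 2.
Proof.
move=> eta01 eta2; rewrite -big_split /=.
pose p z := \prod_(i < n) sign_weight (eta i) (tnth z i).
pose q z := \prod_(i < n) sign_weight (- eta i) (tnth z i).
(* [g] lies below the geometric mean of [p] and [q], because a number in [[0, 1]] is at most its
   square root. Its total mass, the product of the [1 - eta i ^+ 2], thus bounds the Hellinger
   affinity from below. *)
pose g (z : n.-tuple bool) := \prod_(i < n) ((1 - eta i ^+ 2) / 2).
have etaN i : `|eta i| <= 1 by case/andP: (eta01 i) => *; rewrite ger0_norm.
have sq01 i : 0 <= eta i ^+ 2 <= 1.
  by case/andP: (eta01 i) => *; rewrite sqr_ge0 exprn_ile1.
have p0 z : 0 <= p z by apply: prodr_ge0 => i _; exact: sign_weight_ge0.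
have q0 z : 0 <= q z by apply: prodr_ge0 => i _; rewrite sign_weight_ge0 // normrN.
have g0 z : 0 <= g z.
  apply: prodr_ge0 => i _; have /andP[? ?] := sq01 i; lra.
have gpq z : g z ^+ 2 <= p z * q z.
  rewrite -big_split /= -prodrXl; apply: ler_prod => i _; have /andP[? ?] := sq01 i.
  rewrite sqr_ge0 /= [X in _ <= X](_ : _ = (1 - eta i ^+ 2) / 4); last first.
    by rewrite /sign_weight; case: (tnth z i) => /=; field.
  nra.
(* AM-GM: [2 g <= 2 min(p, q) + max(p, q) / 2] *)
have key z : (2 * a ^+ 2) * (g z - (p z + q z) / 4) <=
    p z * (h z - a) ^+ 2 + q z * (h z + a) ^+ 2.
  have := p0 z; have := q0 z; have := g0 z; have := gpq z.
  move: (p z) (q z) (g z) (h z) => u v c y cuv c0 v0 u0.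
  (* Exchanging [u] and [v] amounts to replacing [y] by [- y]. *)
  wlog uv : u v y cuv v0 u0 / u <= v.
    move=> H; have [uv|/ltW vu] := leP u v; first exact: H.
    have := H v u (- y); rewrite mulrC => /(_ cuv u0 v0 vu).
    nra.
  have cle : c <= u + v / 4.
    rewrite -ler_sqr ?nnegrE //; last lra.
    by apply: (le_trans cuv); have := sqr_ge0 (u - v / 4); lra.
  have a2 := sqr_ge0 a.
  (* With [u] the smaller weight, the right side is at least [u] times the sum of the two squares,
     and that sum is [2 * y ^+ 2 + 2 * a ^+ 2]. *)
  apply: (@le_trans _ _ (2 * a ^+ 2 * u)); first by apply: ler_wpM2l; lra.
  have : 0 <= u * y ^+ 2 by rewrite mulr_ge0 ?sqr_ge0.
  have : 0 <= (v - u) * (y + a) ^+ 2 by rewrite mulr_ge0 ?sqr_ge0 // subr_ge0.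
  lra.
(* Summed over [z], [g] gives at least [3/4] and [(p + q) / 4] gives [1/2]; the gap [1/4] times
   [2 * a ^+ 2] is the claimed bound. *)
apply: (le_trans _ (ler_sum _ (fun z _ => key z))).
rewrite -mulr_sumr sumrB -mulr_suml big_split /=.
rewrite (prod_sum_tuple (fun i => sign_weight (eta i))).
rewrite (prod_sum_tuple (fun i => sign_weight (- eta i))).
have -> : \prod_(i < n) \sum_e sign_weight (eta i) e = 1.
  by rewrite big1 // => i _; exact: sign_weight_sum.
have -> : \prod_(i < n) \sum_e sign_weight (- eta i) e = 1.
  by rewrite big1 // => i _; exact: sign_weight_sum.
rewrite (prod_sum_tuple (fun i _ => (1 - eta i ^+ 2) / 2)).
have -> : \prod_(i < n) \sum_(e : bool) ((1 - eta i ^+ 2) / 2) = \prod_(i < n) (1 - eta i ^+ 2).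
  by apply: eq_bigr => i _; rewrite big_bool /=; field.
have := @prod_1subr_ge n (fun i => eta i ^+ 2).
move=> /(_ sq01); have := sqr_ge0 a; nra.
Qed.

End LeCam.

(** * Measurability of the loss and of contamination *)

Section Measurability.
Variable R : realType.

Lemma measurable_sqdist d (mu : vec R d) :
  measurable_fun setT (fun v : vec R d => sqnorm [tuple tnth v i - tnth mu i | i < d]).
Proof.
apply: measurable_sum => i; under eq_fun do rewrite tnth_mktuple.
apply: measurable_funX; apply: measurable_funB => //; exact: measurable_tnth.
Qed.

Lemma measurable_contaminate d n (x : n.-tuple (vec R d)) b :
  measurable_fun setT (contaminate x b).
Proof.
apply/measurable_fun_tnthP => i.
rewrite (_ : _ \o _ = fun y => if tnth b i then tnth y i else tnth x i).
  by case: (tnth b i) => //; exact: measurable_tnth.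
by apply/funext => y; rewrite /= tnth_mktuple.
Qed.

Lemma measurable_contaminate_l d n (y : n.-tuple (vec R d)) b :
  measurable_fun setT (fun x => contaminate x b y).
Proof.
apply/measurable_fun_tnthP => i.
rewrite (_ : _ \o _ = fun x => if tnth b i then tnth y i else tnth x i).
  by case: (tnth b i) => //; exact: measurable_tnth.
by apply/funext => x; rewrite /= tnth_mktuple.
Qed.

End Measurability.

(** * The risk under finitely supported laws as a finite sum *)

Section MixtureRisk.
Variables (R : realType) (d : nat).

Lemma iter_int_mixture (I : finType) (w : I -> R) (pt : I -> vec R d)
    (w0 : forall i, 0 <= w i) (w1 : \sum_i w i = 1) n (g : n.-tuple (vec R d) -> R) :
  measurable_fun setT g ->
  iter_int (mixture_probability pt w0 w1) (fun x => (g x)%:E) =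
  (\sum_(t : n.-tuple I) (\prod_(i < n) w (tnth t i)) * g (map_tuple pt t))%:E.
Proof.
elim: n g => [|n ih] g mg /=.
  rewrite (big_pred1 [tuple]) => [|t]; last by symmetry; apply/eqP; exact: tuple0.
  by rewrite big_ord0 mul1r; congr (g _)%:E; apply: val_inj.
transitivity (\int[mixture pt w0]_x (\sum_(t : n.-tuple I)
    (\prod_(i < n) w (tnth t i)) * g [tuple of x :: map_tuple pt t])%:E)%E.
  apply: eq_integral => x _; rewrite (ih (fun t => g [tuple of x :: t])) //.
  by apply: (measurableT_comp mg); exact: measurable_cons.
rewrite integral_mixture_EFin.
  congr EFin; rewrite reindex_cons_tuple; apply: eq_bigr => e _.
  rewrite mulr_sumr; apply: eq_bigr => t _.
  rewrite big_ord_recl mulrA; congr (_ * _ * g _); last exact: val_inj.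
  by apply: eq_bigr => i _; rewrite tnthS.
apply: measurable_sum => t; apply: measurable_funM => //.
by apply: (measurableT_comp mg); exact: measurable_cons.
Qed.

(** An adversary blind to the sample and the flags; the lower bound uses only adversaries of this
    kind. *)
Definition const_adversary n (Q : pprobability (n.-tuple (vec R d)) R) : adversary R d n :=
  fun _ => kprobability (measurable_cst Q).

(** Every integral becomes a finite sum over bits, and [sum_mix] collapses them: the observations
    are independent, the [i]-th with the mixture of [p] and [q i] as its law. The outlier law may
    vary with [i] so that it can be tuned to [lam i]. *)
Lemma risk_mixture n (lam : 'I_n -> R) (M : n.-tuple (vec R d) -> vec R d)
    (pt : bool -> vec R d) (p : bool -> R) (q : 'I_n -> bool -> R)
    (p0 : forall b, 0 <= p b) (p1 : \sum_b p b = 1)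
    (q0 : forall t : n.-tuple bool, 0 <= \prod_(i < n) q i (tnth t i))
    (q1 : \sum_(t : n.-tuple bool) \prod_(i < n) q i (tnth t i) = 1) :
  (forall i, \sum_b q i b = 1) ->
  measurable_fun setT M ->
  let P := mixture_probability pt p0 p1 in
  risk lam M P (const_adversary (mixture_probability (map_tuple pt) q0 q1)) =
  (\sum_(z : n.-tuple bool)
    (\prod_(i < n) ((1 - lam i) * p (tnth z i) + lam i * q i (tnth z i))) *
    sqnorm [tuple tnth (M (map_tuple pt z)) i - tnth (mean P) i | i < d])%:E.
Proof.
move=> qs mM P; rewrite /risk.
set F := fun v : vec R d => sqnorm [tuple tnth v i - tnth (mean P) i | i < d].
have mF : measurable_fun setT F by exact: measurable_sqdist.
have mFM : measurable_fun setT (F \o M) by exact: measurableT_comp.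
have inner (b : n.-tuple bool) :
    iter_int P (fun x => \int[const_adversary (mixture_probability (map_tuple pt) q0 q1) b x]_(y in setT)
       (F (M (contaminate x b y)))%:E)%E =
    (\sum_(x : n.-tuple bool) (\prod_(i < n) p (tnth x i)) *
      (\sum_(y : n.-tuple bool) (\prod_(i < n) q i (tnth y i)) *
         (F \o M \o map_tuple pt) (mix x b y)))%:E.
  pose h x (y : n.-tuple bool) := F (M (contaminate x b (map_tuple pt y))).
  transitivity (iter_int P (fun x => (\sum_(y : n.-tuple bool)
      (\prod_(i < n) q i (tnth y i)) * h x y)%:E)).
    congr (iter_int P _); apply/funext => x.
    apply: (@integral_mixture_EFin _ _ R _ _ (map_tuple pt) q0 ((F \o M) \o contaminate x b)).
    by apply: measurableT_comp => //; exact: measurable_contaminate.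
  rewrite iter_int_mixture; last first.
    apply: measurable_sum => y; apply: measurable_funM => //.
    exact: (measurableT_comp mFM (measurable_contaminate_l _ _)).
  congr EFin; apply: eq_bigr => x _; congr (_ * _); apply: eq_bigr => y _.
  congr (_ * F (M _)); apply: eq_from_tnth => i.
  by rewrite !(tnth_mktuple, tnth_map); case: ifP.
under eq_bigr do rewrite inner -EFinM.
rewrite sumEFin; congr EFin.
rewrite (sum_mix (fun i (b : bool) => if b then lam i else 1 - lam i) (fun=> p)).
by apply: eq_bigr => z _; congr (_ * _); apply: eq_bigr => i _; rewrite qs p1 !mulr1.
Qed.

End MixtureRisk.

(** * Hypotheses supported on two opposite points of an axis *)

Section TwoPoint.
Variables (R : realType) (d : nat) (r : R).

Definition axis_point (b : bool) : vec R d.+1 :=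
  [tuple if i == ord0 then (if b then r else - r) else 0 | i < d.+1].

Lemma sqnorm_axis_point b : sqnorm (axis_point b) = r ^+ 2.
Proof.
rewrite /sqnorm (bigD1 ord0) //= big1 => [|i /negbTE i0].
  by rewrite tnth_mktuple eqxx addr0; case: b; rewrite ?sqrrN.
by rewrite tnth_mktuple i0 expr0n.
Qed.

Lemma measurable_sqnorm k : measurable_fun setT (@sqnorm R k).
Proof.
by apply: measurable_sum => i; apply: measurable_funX; exact: measurable_tnth.
Qed.

Lemma measurable_sqnorm_le k : measurable [set x : vec R k | sqnorm x <= r ^+ 2].
Proof.
have := @measurable_fun_ler _ _ R setT (@sqnorm R k) (cst (r ^+ 2)) (@measurable_sqnorm k)
  (measurable_cst _).
move=> /(_ measurableT [set true] I); rewrite setTI; congr measurable.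
Qed.

Lemma mean_mixture k (I : finType) (w : I -> R) (pt : I -> vec R k)
    (w0 : forall i, 0 <= w i) (w1 : \sum_i w i = 1) j :
  tnth (mean (mixture_probability pt w0 w1)) j = \sum_i w i * tnth (pt i) j.
Proof.
rewrite tnth_mktuple /Rintegral integral_mixture_EFin //; exact: measurable_tnth.
Qed.

Lemma mixture_ball_class k (I : finType) (w : I -> R) (pt : I -> vec R k)
    (w0 : forall i, 0 <= w i) (w1 : \sum_i w i = 1) :
  (forall i, sqnorm (pt i) <= r ^+ 2) -> @ball_class R k r (mixture_probability pt w0 w1).
Proof.
move=> ptr; rewrite /ball_class /=.
have mB := @measurable_sqnorm_le k.
rewrite -[[set x | _]]setIT -integral_indic // integral_mixture_EFin //.
rewrite (eq_bigr w) ?w1 // => i _.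
by rewrite indicE mem_set ?mulr1 //; exact: ptr.
Qed.

(** In units of [r], the clean mean is [th] and the outlier at index [i] has mean [m i]. The law and
    the adversary are fixed before the estimator. *)
Lemma two_point_risk n (lam : 'I_n -> R) (th : R) (m : 'I_n -> R) :
  (forall i, 0 <= lam i <= 1) -> `|th| <= 1 -> (forall i, `|m i| <= 1) ->
  exists P A, @ball_class R d.+1 r P /\
    forall M : n.-tuple (vec R d.+1) -> vec R d.+1, measurable_fun setT M ->
    ((\sum_(z : n.-tuple bool)
      (\prod_(i < n) sign_weight ((1 - lam i) * th + lam i * m i) (tnth z i)) *
      (tnth (M (map_tuple axis_point z)) ord0 - th * r) ^+ 2)%:E <= risk lam M P A)%E.
Proof.
move=> lam01 th1 m1.
pose p0 b := sign_weight_ge0 b th1.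
pose p1 := sign_weight_sum th.
have q0 (t : n.-tuple bool) : 0 <= \prod_(i < n) sign_weight (m i) (tnth t i).
  by apply: prodr_ge0 => i _; exact: sign_weight_ge0.
have q1 : \sum_(t : n.-tuple bool) \prod_(i < n) sign_weight (m i) (tnth t i) = 1.
  rewrite (prod_sum_tuple (fun i => sign_weight (m i))) big1 // => i _.
  exact: sign_weight_sum.
exists (mixture_probability axis_point p0 p1).
exists (const_adversary (mixture_probability (map_tuple axis_point) q0 q1)).
split=> [|M mM]; first by apply: mixture_ball_class => b; rewrite sqnorm_axis_point.
rewrite (@risk_mixture _ _ _ lam M _ _ (fun i => sign_weight (m i)) p0 p1 q0 q1) //; last first.
  by move=> i; exact: sign_weight_sum.
rewrite lee_fin; apply: ler_sum => z _.
(* [sign_weight] is affine in the mean, so a mixture of two sign laws is the sign law with the mixed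
   mean. *)
have weightE i : sign_weight ((1 - lam i) * th + lam i * m i) (tnth z i) =
    (1 - lam i) * sign_weight th (tnth z i) + lam i * sign_weight (m i) (tnth z i).
  by rewrite /sign_weight; case: (tnth z i) => /=; field.
under eq_bigr do rewrite weightE.
apply: ler_wpM2l.
  apply: prodr_ge0 => i _; have /andP[l0 l1] := lam01 i.
  by rewrite addr_ge0 // mulr_ge0 ?subr_ge0 ?sign_weight_ge0.
(* Only the first coordinate of the loss is kept; the others are nonnegative. *)
rewrite /sqnorm (bigD1 ord0) //= tnth_mktuple mean_mixture big_bool !tnth_mktuple /=.
rewrite [X in (_ - X) ^+ 2 + _](_ : _ = th * r).
  by rewrite lerDl sumr_ge0 // => i _; exact: sqr_ge0.
by rewrite /sign_weight /=; field.
Qed.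

End TwoPoint.

(** Passes from the classical sets in which [fval] counts indices to boolean predicates. *)
Lemma card_set_bool (I : finType) (P : pred I) : #|[set i | P i]| = #|P|.
Proof. by apply: eq_card => i; rewrite unfold_in /= asboolb. Qed.

(** * Choice of the scale and the minimax lower bound *)

Section LowerBound.
Variable R : realType.

Lemma minimax_ge_separation d (r : R) n (lam : 'I_n -> R) (th : R) :
  0 <= r -> (forall i, 0 <= lam i <= 1) -> 0 < th <= 1 ->
  #|[set i | lam i < th]|%:R * th ^+ 2 <= 4^-1 :> R ->
  ((th ^+ 2 * r ^+ 2 / 4)%:E <= @minimax_rate R d.+1 n lam r)%E.
Proof.
move=> r0 lam01 /andP[th0 th1] Nth; apply/ereal_infP => _ [M mM <-].
(* With contamination rate at least [th] the adversary can centre [Z_i]. *)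
pose m i := if lam i < th then th else - ((1 - lam i) * th / lam i).
(* The mean of the [i]-th observation in units of [r]: below [th] the outliers copy the clean law,
   elsewhere the two means cancel. *)
pose eta i := if lam i < th then th else 0.
have eta01 i : 0 <= eta i <= 1 by rewrite /eta; case: ifP; rewrite ?lexx ?ler01 ?th1 ?ltW.
have etaE i : (1 - lam i) * th + lam i * m i = eta i.
  rewrite /m /eta; case: ltP => [_|lt]; first by ring.
  by field; rewrite gt_eqF // (lt_le_trans th0).
have etaNE i : (1 - lam i) * - th + lam i * - m i = - eta i by rewrite -etaE; ring.
have m1 i : `|m i| <= 1.
  rewrite /m; case: ltP => [_|lt]; first by rewrite ger0_norm // ltW.
  (* From [th <= lam i] follows [(1 - lam i) * th <= lam i], so the centring mean stays in
     [[-1, 1]]. *)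
  have l0 := lt_le_trans th0 lt; have /andP[_ l1] := lam01 i.
  have num0 : 0 <= (1 - lam i) * th by rewrite mulr_ge0 ?subr_ge0 // ltW.
  rewrite normrN ger0_norm; last by rewrite divr_ge0 // ltW.
  by rewrite ler_pdivrMr // mul1r; nra.
have thn1 : `|th| <= 1 by rewrite ger0_norm // ltW.
have [P [A [PA /(_ M mM) rA]]] := two_point_risk d r lam01 thn1 m1.
have thNn1 : `|- th| <= 1 by rewrite normrN.
have mN1 i : `|- m i| <= 1 by rewrite normrN.
have [P' [A' [PA' /(_ M mM) rA']]] := two_point_risk d r lam01 thNn1 mN1.
have eta2 : \sum_i eta i ^+ 2 <= 4^-1.
  apply: le_trans Nth.
  rewrite card_set_bool -sum1_card natr_sum mulr_suml [leRHS]big_mkcond /=.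
  by apply: ler_sum => i _; rewrite unfold_in /eta; case: ifP; rewrite ?mul1r ?expr0n.
have := le_cam_two_point (fun z => tnth (M (map_tuple (axis_point d r) z)) ord0) (th * r) eta01 eta2.
set S1 := \sum_z _; set S2 := \sum_z _ => S12.
have S1E : (S1%:E <= risk lam M P A)%E.
  apply: le_trans rA; rewrite lee_fin; apply: ler_sum => z _.
  by under [in leRHS]eq_bigr do rewrite etaE.
have S2E : (S2%:E <= risk lam M P' A')%E.
  apply: le_trans rA'; rewrite lee_fin; apply: ler_sum => z _.
  by under [in leRHS]eq_bigr do rewrite etaNE; rewrite mulNr opprK.
(* The two risks add up to at least [(th * r) ^+ 2 / 2], so one of them reaches half of that. *)
have [hS|hS] := leP ((th * r) ^+ 2 / 4) S1.
  apply: (@le_trans _ _ (risk lam M P A)).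
    by apply: le_trans S1E; rewrite lee_fin; apply: le_trans hS; rewrite exprMn.
  by apply: ereal_sup_ubound; exists P => //; exists A.
apply: (@le_trans _ _ (risk lam M P' A')).
  by apply: le_trans S2E; rewrite lee_fin -exprMn; lra.
by apply: ereal_sup_ubound; exists P' => //; exists A'.
Qed.

Lemma frate_le n (lam : 'I_n -> R) (t : R) : 0 <= t <= 1 ->
  (0 < #|[pred i | (lam i <= t)%R]|)%N ->
  (frate lam 1 <= (#|[pred i | lam i <= t]|%:R^-1 + t ^+ 2)%:E)%E.
Proof.
move=> t01 N0; apply: ereal_inf_lbound; exists t; first by rewrite /= in_itv.
by rewrite /fval card_set_bool gtn_eqF // mul1r -EFinD.
Qed.

Lemma dyadic_scale n (lam : 'I_n -> R) : (1 <= n)%N -> (forall i, lam i <= 1) ->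
  exists2 th : R, 0 < th <= 1 /\ #|[set i | lam i < th]|%:R * th ^+ 2 <= 4^-1 &
    (frate lam 1 <= (20 * th ^+ 2)%:E)%E.
Proof.
move=> n1 lam1; pose th k : R := 2^-1 ^+ k.
have th0 k : 0 < th k by rewrite exprn_gt0.
have th1 k : th k <= 1 by rewrite exprn_ile1 ?invr_ge0 // invf_le1 // ler1n.
pose good k := #|[set i | lam i < th k]|%:R * th k ^+ 2 <= 4^-1 :> R.
(* The search for a scale ends because [4 * n <= 4 ^ n] for [n >= 1]. *)
have good_n : good n.
  apply: (@le_trans _ _ (n%:R * th n ^+ 2)).
    by rewrite ler_wpM2r ?sqr_ge0 // ler_nat (leq_trans (max_card _)) ?card_ord.
  rewrite /th -exprM mulnC exprM exprVn -[2 ^+ 2]natrX exprVn -natrX.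
  rewrite ler_pdivrMr ?ltr0n ?expn_gt0 // ler_pdivlMl // -natrM ler_nat.
  by case: n n1 {lam lam1 good} => // k _; rewrite [leqRHS]expnS leq_mul2l ltn_expl.
(* At a bad scale the count exceeds [1 / (4 * th k ^+ 2)], so taking [t = th k] bounds the rate by
   [4 * th k ^+ 2 + th k ^+ 2]. *)
have fle k : ~~ good k -> (frate lam 1 <= (5 * th k ^+ 2)%:E)%E.
  rewrite /good -ltNge card_set_bool => bad.
  have le_card : (#|[pred i | (lam i < th k)%R]| <= #|[pred i | (lam i <= th k)%R]|)%N.
    by apply/subset_leq_card/fintype.subsetP => i; rewrite !inE => /ltW.
  have N0 : (0 < #|[pred i | (lam i < th k)%R]|)%N.
    rewrite lt0n; apply/negP => /eqP N0; move: bad.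
    by rewrite N0 mul0r ltNge invr_ge0 ler0n.
  have N0' := leq_trans N0 le_card.
  apply: le_trans (frate_le _ N0') _; first by rewrite ltW //= th1.
  rewrite lee_fin -lerBrDr -[_^-1]mul1r ler_pdivrMr ?ltr0n //.
  move: le_card bad; rewrite -(ler_nat R) => /(ler_wpM2r (sqr_ge0 (th k))).
  lra.
have exg : exists k, good k by exists n.
(* The least good exponent gives the largest good scale. Its predecessor is bad and twice as large,
   whence [20 = 5 * 4]. *)
case: (ex_minnP exg) => -[|k] gk kmin; last first.
  exists (th k.+1) => //; first by rewrite th0 th1.
  have /fle : ~~ good k by apply/negP => /kmin; rewrite ltnn.
  have -> : th k.+1 = 2^-1 * th k by rewrite /th exprS.
  by move=> /le_trans; apply; rewrite lee_fin; lra.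
(* If the scale [1] is already good, [t = 1] counts every index and the rate is at most [2]. *)
exists (th 0) => //; first by rewrite th0 th1.
have cardn : #|[pred i | lam i <= 1]| = n.
  by rewrite -[RHS]card_ord; apply: eq_card => i; rewrite !inE lam1.
apply: le_trans (frate_le (t := 1) _ _) _; rewrite ?cardn ?ler01 ?lexx //.
rewrite lee_fin /th expr0 expr1n.
have : n%:R^-1 <= 1 :> R by rewrite invf_le1 ?ler1n ?ltr0n.
lra.
Qed.

Lemma minimax_lower_bound d (r : R) n (lam : 'I_n -> R) :
  (1 <= n)%N -> 0 <= r -> (forall i, 0 <= lam i <= 1) ->
  ((80^-1 * r ^+ 2)%:E * frate lam 1 <= @minimax_rate R d.+1 n lam r)%E.
Proof.
move=> n1 r0 lam01.
have lam1 i : lam i <= 1 by case/andP: (lam01 i).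
have [th [th01 Nth] fth] := dyadic_scale n1 lam1.
apply: le_trans (minimax_ge_separation d r0 lam01 th01 Nth).
(* [1/80] is the [1/4] of the two-point bound divided by the [20] of the scale. *)
have c0 : 0 <= 80^-1 * r ^+ 2 :> R by rewrite mulr_ge0 ?sqr_ge0.
apply: (le_trans (lee_wpmul2l _ fth)); first by rewrite lee_fin.
by rewrite -EFinM lee_fin; lra.
Qed.
End LowerBound.

(** * The upper bound *)

Section IteratedIntegral.
Variable R : realType.

(** The integral of a nonnegative function is a supremum over the simple functions below it, hence
    monotone. It applies directly to the nested integrals of the risk. *)
Lemma le_integralT d (T : measurableType d) (mu : {measure set T -> \bar R})
    (f g : T -> \bar R) : (forall x, 0 <= f x)%E -> (forall x, f x <= g x)%E ->
  (\int[mu]_x f x <= \int[mu]_x g x)%E.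
Proof.
move=> f0 fg; have g0 x : (0 <= g x)%E := le_trans (f0 x) (fg x).
rewrite !ge0_integralTE //; apply: le_ereal_sup => _ [h hf <-].
by exists h => // x; exact: le_trans (hf x) (fg x).
Qed.

Lemma iter_int_ge0 d (P : probability (vec R d) R) n (g : n.-tuple (vec R d) -> \bar R) :
  (forall x, 0 <= g x)%E -> (0 <= iter_int P g)%E.
Proof.
elim: n g => [|n ih] g g0 /=; first exact: g0.
by apply: integral_ge0 => x _; exact: ih.
Qed.

Lemma le_iter_int d (P : probability (vec R d) R) n (g h : n.-tuple (vec R d) -> \bar R) :
  (forall x, 0 <= g x)%E -> (forall x, g x <= h x)%E -> (iter_int P g <= iter_int P h)%E.
Proof.
elim: n g h => [|n ih] g h g0 gh /=; first exact: gh.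
by apply: le_integralT => x; [exact: iter_int_ge0 | exact: ih].
Qed.

End IteratedIntegral.

(** * Expectations of bounded measurable functions *)

Section Moments.
Context d0 (T : measurableType d0) (R : realType) (P : probability T R).

(** A class closed under sums and products and contained in the integrable functions, serving as the
    single side condition for the algebra of expectations. *)
Definition bounded_mfun (f : T -> R) :=
  measurable_fun setT f /\ exists B : R, forall x, `|f x| <= B.

Lemma bounded_mfun_integrable f : bounded_mfun f -> P.-integrable setT (EFin \o f).
Proof.
move=> [mf [B fB]]; apply: measurable_bounded_integrable => //.
  by rewrite (le_lt_trans (probability_le1 P measurableT)) ?ltry.
exists B; split; first exact: num_real.
by move=> C BC x _; apply: le_trans (ltW BC).
Qed.

Lemma bounded_mfun_cst c : bounded_mfun (cst c).
Proof. by split; [exact: measurable_cst | exists `|c|]. Qed.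

Lemma bounded_mfunD f g : bounded_mfun f -> bounded_mfun g ->
  bounded_mfun (fun x => f x + g x).
Proof.
move=> [mf [B fB]] [mg [C gC]]; split; first exact: measurable_funD.
by exists (B + C) => x; rewrite (le_trans (ler_normD _ _)) // lerD.
Qed.

Lemma bounded_mfunM f g : bounded_mfun f -> bounded_mfun g ->
  bounded_mfun (fun x => f x * g x).
Proof.
move=> [mf [B fB]] [mg [C gC]]; split; first exact: measurable_funM.
by exists (B * C) => x; rewrite normrM ler_pM.
Qed.

Lemma bounded_mfun_sum I (s : seq I) (f : I -> T -> R) : (forall i, bounded_mfun (f i)) ->
  bounded_mfun (fun x => \sum_(i <- s) f i x).
Proof.
move=> bf; elim: s => [|i s ih].
  by under eq_fun do rewrite big_nil; exact: bounded_mfun_cst.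
by under eq_fun do rewrite big_cons; exact: bounded_mfunD.
Qed.

Local Notation E f := (Rintegral P setT f).

Lemma integral_bounded_mfun f : bounded_mfun f ->
  (\int[P]_x (f x)%:E)%E = (E f)%:E.
Proof.
by move=> bf; rewrite /Rintegral fineK //; apply: integrable_fin_num => //;
  exact: bounded_mfun_integrable.
Qed.

Lemma expect_cst c : E (cst c) = c.
Proof.
rewrite Rintegral_cst //; have /= -> := probability_setT P.
by rewrite mulr1.
Qed.

Lemma expect_sum I (s : seq I) (f : I -> T -> R) : (forall i, bounded_mfun (f i)) ->
  E (fun x => \sum_(i <- s) f i x) = \sum_(i <- s) E (f i).
Proof.
move=> bf; elim: s => [|i s ih].
  by under eq_fun do rewrite big_nil; rewrite big_nil; exact: expect_cst.
under eq_fun do rewrite big_cons.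
rewrite big_cons RintegralD ?ih //; apply: bounded_mfun_integrable => //.
exact: bounded_mfun_sum.
Qed.

Lemma expect_affine c a f : bounded_mfun f -> E (fun x => c * f x + a) = c * E f + a.
Proof.
move=> bf; have bc := bounded_mfun_cst; rewrite RintegralD //.
- by rewrite RintegralZl ?(expect_cst a) //; exact: bounded_mfun_integrable.
- by apply: bounded_mfun_integrable; exact: (bounded_mfunM (bc c)).
- exact: (bounded_mfun_integrable (bc a)).
Qed.

Lemma expect_sqr_affine a s f : bounded_mfun f ->
  E (fun x => (a + s * f x) ^+ 2) = a ^+ 2 + 2 * a * s * E f + s ^+ 2 * E (fun x => f x ^+ 2).
Proof.
move=> bf; have bc := bounded_mfun_cst.
rewrite (_ : (fun x => (a + s * f x) ^+ 2) =
  (fun x => (2 * a * s) * f x + ((s ^+ 2) * (f x ^+ 2) + a ^+ 2))); last first.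
  by apply/funext => x; ring.
have bf2 : bounded_mfun (fun x => f x ^+ 2) := bounded_mfunM bf bf.
have bsf : bounded_mfun (fun x => 2 * a * s * f x) := bounded_mfunM (bc _) bf.
have bsf2 : bounded_mfun (fun x => s ^+ 2 * f x ^+ 2 + a ^+ 2).
  exact: (bounded_mfunD (bounded_mfunM (bc _) bf2) (bc _)).
rewrite RintegralD //; try exact: bounded_mfun_integrable.
rewrite RintegralZl ?expect_affine //; last exact: bounded_mfun_integrable.
ring.
Qed.

End Moments.

(** * Second moment of a weighted sum of i.i.d. centred vectors *)

Section IteratedSecondMoment.
Variables (R : realType) (d : nat) (P : probability (vec R d) R).
Variable Y : 'I_d -> vec R d -> R.
Hypothesis bY : forall j, bounded_mfun (Y j).
Hypothesis EY : forall j, Rintegral P setT (Y j) = 0.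

Let V := \sum_j Rintegral P setT (fun x => Y j x ^+ 2).

(** Independence and centring remove the cross terms. The offset [a] absorbs the variables fixed by
    the outer integrals, which lets the induction proceed inwards. *)
Lemma iter_int_sqr_sum n (s : 'I_n -> R) (a : 'I_d -> R) c C :
  iter_int P (fun x => (c * (\sum_j (a j + \sum_i s i * Y j (tnth x i)) ^+ 2) + C)%:E) =
  (c * ((\sum_j a j ^+ 2) + (\sum_i s i ^+ 2) * V) + C)%:E.
Proof.
elim: n s a => [|n ih] s a.
  rewrite /= big_ord0 mul0r addr0; congr (c * _ + C)%:E.
  by apply: eq_bigr => j _; rewrite big_ord0 addr0.
have bsq j : bounded_mfun (fun x => (a j + s ord0 * Y j x) ^+ 2).
  have bl := bounded_mfunD (bounded_mfun_cst _ (a j)) (bounded_mfunM (bounded_mfun_cst _ (s ord0)) (bY j)).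
  exact: (bounded_mfunM bl bl).
have bsum := bounded_mfun_sum (index_enum 'I_d) bsq.
pose C' := c * ((\sum_(i < n) s (lift ord0 i) ^+ 2) * V) + C.
transitivity (\int[P]_x (c * (\sum_j (a j + s ord0 * Y j x) ^+ 2) + C')%:E)%E.
  apply: eq_integral => x _; rewrite /C' addrA -mulrDr -ih; congr (iter_int P _).
  apply/funext => t; congr (c * _ + C)%:E; apply: eq_bigr => j _.
  rewrite big_ord_recl addrA; congr ((_ + _) ^+ 2).
  by apply: eq_bigr => i _; rewrite tnthS.
rewrite integral_bounded_mfun; last first.
  apply: (bounded_mfunD (bounded_mfunM (bounded_mfun_cst _ c) bsum)); exact: bounded_mfun_cst.
rewrite expect_affine // expect_sum //; congr EFin.
under eq_bigr do rewrite expect_sqr_affine // EY mulr0 addr0.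
rewrite big_split /= -mulr_sumr -/V /C' big_ord_recl; ring.
Qed.

End IteratedSecondMoment.

(** * The clipped average and its deterministic error bound *)

Section ClippedAverage.
Variable R : realType.

(** Points outside the ball go to the origin: this bounds every outlier and, for a law in
    [ball_class], changes clean data only on a null set. *)
Definition clip d (r : R) (x : vec R d) : vec R d :=
  if sqnorm x <= r ^+ 2 then x else [tuple 0 | _ < d].

Lemma sqnorm_ge0 d (x : vec R d) : 0 <= sqnorm x.
Proof. by apply: sumr_ge0 => i _; exact: sqr_ge0. Qed.

Lemma sqnorm_clip d r (x : vec R d) : sqnorm (clip r x) <= r ^+ 2.
Proof.
rewrite /clip; case: ifP => // _; rewrite /sqnorm big1 ?sqr_ge0 // => i _.
by rewrite tnth_mktuple expr0n.
Qed.

Lemma measurable_clip d r : measurable_fun setT (@clip d r).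
Proof.
apply: measurable_fun_ifT => //.
by apply: measurable_fun_ler => //; exact: measurable_sqnorm.
Qed.

Lemma bounded_mfun_clip d r j : bounded_mfun (fun x : vec R d => tnth (clip r x) j).
Proof.
split.
  exact: (measurableT_comp (measurable_tnth j) (@measurable_clip d r)).
exists `|r| => x; rewrite -ler_sqr ?nnegrE // !real_normK ?num_real //.
apply: le_trans (sqnorm_clip r x); rewrite /sqnorm (bigD1 j) //= lerDl.
by apply: sumr_ge0 => i _; exact: sqr_ge0.
Qed.

Lemma mean_clip d r (P : probability (vec R d) R) j : ball_class r P ->
  tnth (mean P) j = Rintegral P setT (fun x => tnth (clip r x) j).
Proof.
move=> Pr; rewrite tnth_mktuple; congr fine; apply: ae_eq_integral => //.
- by apply/measurable_EFinP; exact: measurable_tnth.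
- by have [mc _] := bounded_mfun_clip r j; exact/measurable_EFinP.
exists (~` [set x | sqnorm x <= r ^+ 2]); split.
- by apply: measurableC; exact: measurable_sqnorm_le.
- have /= -> := probability_setC P (@measurable_sqnorm_le R r d).
  by rewrite Pr subee.
- by move=> x /=; apply: contra_not => xr _; rewrite /clip xr.
Qed.

(** Centring at the mean only lowers the second moment, which clipping bounds by [r ^+ 2]. *)
Lemma clip_second_moment d r (P : probability (vec R d) R) : ball_class r P ->
  \sum_j Rintegral P setT (fun x => (tnth (clip r x) j - tnth (mean P) j) ^+ 2) <= r ^+ 2.
Proof.
move=> Pr; have bc := @bounded_mfun_clip d r.
have bc2 j : bounded_mfun (fun x : vec R d => tnth (clip r x) j ^+ 2).
  exact: (bounded_mfunM (bc j) (bc j)).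
apply: (@le_trans _ _ (\sum_j Rintegral P setT (fun x => tnth (clip r x) j ^+ 2))).
  apply: ler_sum => j _; set mu := tnth (mean P) j.
  rewrite (_ : (fun x => _) = fun x => (- mu + 1 * tnth (clip r x) j) ^+ 2); last first.
    by apply/funext => x; ring.
  rewrite expect_sqr_affine // -mean_clip // -/mu; have := sqr_ge0 mu; lra.
rewrite -expect_sum // -[leRHS](expect_cst P); apply: le_Rintegral => //.
- by apply: bounded_mfun_integrable; exact: bounded_mfun_sum.
- by apply: bounded_mfun_integrable; exact: bounded_mfun_cst.
- by move=> x _; exact: sqnorm_clip.
Qed.

(** Weighted Cauchy-Schwarz: the gap is half the sum of [w i * w k * (x i - x k) ^+ 2], visible once
    the right side is symmetrized. *)
Lemma sqr_sum_le (I : finType) (w x : I -> R) : (forall i, 0 <= w i) ->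
  (\sum_i w i * x i) ^+ 2 <= (\sum_i w i) * \sum_i w i * x i ^+ 2.
Proof.
move=> w0; set W := \sum_i w i; set Q := \sum_i w i * x i ^+ 2.
have -> : W * Q = (W * Q + Q * W) / 2 by field.
rewrite expr2 !big_distrlr /= -big_split mulr_suml; apply: ler_sum => i _.
rewrite -big_split mulr_suml; apply: ler_sum => k _ /=.
have : 0 <= w i * w k * (x i - x k) ^+ 2 by rewrite mulr_ge0 ?sqr_ge0 // mulr_ge0.
lra.
Qed.

Lemma clip_diff_le d r (x y : vec R d) :
  \sum_j (tnth (clip r y) j - tnth (clip r x) j) ^+ 2 <= 4 * r ^+ 2.
Proof.
apply: (@le_trans _ _ (2 * sqnorm (clip r y) + 2 * sqnorm (clip r x))).
  rewrite /sqnorm !mulr_sumr -big_split /=; apply: ler_sum => j _.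
  have := sqr_ge0 (tnth (clip r y) j + tnth (clip r x) j); lra.
have := sqnorm_clip r x; have := sqnorm_clip r y; lra.
Qed.

(** * Second moment of the number of contaminated indices *)

Section BernoulliMoment.
Variables (n : nat) (lam : 'I_n -> R).

Lemma bern_weight_sum : \sum_(b : n.-tuple bool) bern_weight lam b = 1.
Proof.
rewrite (prod_sum_tuple (fun i (b : bool) => if b then lam i else 1 - lam i)).
by rewrite big1 // => i _; rewrite big_bool /= addrC subrK.
Qed.

Lemma bern_weight_ge0 b : (forall i, 0 <= lam i <= 1) -> 0 <= bern_weight lam b.
Proof.
by move=> l01; apply: prodr_ge0 => i _; have /andP[? ?] := l01 i; case: ifP; rewrite ?subr_ge0.
Qed.

Lemma prod_pair (F : 'I_n -> R) i k :
  \prod_l (if (l == i) || (l == k) then F l else 1) = if i == k then F i else F i * F k.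
Proof.
rewrite -big_mkcond (bigD1 i) ?eqxx //=; case: eqVneq => [<-|ik].
  by rewrite big1 ?mulr1 // => l; rewrite orbb => /andP[->].
rewrite (bigD1 k) /=; last by rewrite eqxx orbT eq_sym.
by rewrite big1 ?mulr1 // => l; case: (l == i); case: (l == k).
Qed.

(** Distinct flags are independent, while a flag equals its own square. *)
Lemma bern_weight_pair i k :
  \sum_(b : n.-tuple bool) bern_weight lam b * ((tnth b i)%:R * (tnth b k)%:R) =
  if i == k then lam i else lam i * lam k.
Proof.
rewrite -prod_pair.
transitivity (\sum_(b : n.-tuple bool) \prod_l ((if tnth b l then lam l else 1 - lam l) *
    (if (l == i) || (l == k) then (tnth b l)%:R else 1))).
  apply: eq_bigr => b _; rewrite big_split /= (prod_pair (fun l => (tnth b l)%:R)).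
  by congr (_ * _); case: eqVneq => // ->; case: (tnth b k); rewrite ?mulr1 ?mulr0.
rewrite (prod_sum_tuple (fun l (e : bool) => (if e then lam l else 1 - lam l) *
  (if (l == i) || (l == k) then e%:R else 1))).
by apply: eq_bigr => l _; rewrite big_bool /=; case: ifP => _; ring.
Qed.

(** An off-diagonal pair contributes at most [t ^+ 2]; a diagonal one is allotted [t ^+ 2 + 1], so
    that the total takes a closed form. *)
Lemma bern_sum_sqr_le (t : R) (S : pred 'I_n) : t <= 1 -> (forall i, 0 <= lam i <= 1) ->
  {in S, forall i, lam i <= t} ->
  \sum_(b : n.-tuple bool) bern_weight lam b * (\sum_(i in S) (tnth b i)%:R) ^+ 2 <=
  #|S|%:R ^+ 2 * t ^+ 2 + #|S|%:R.
Proof.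
move=> t1 l01 St.
under eq_bigr do rewrite expr2 big_distrlr /= mulr_sumr.
rewrite exchange_big /=.
apply: (@le_trans _ _ (\sum_(i in S) (#|S|%:R * t ^+ 2 + 1))); last first.
  by rewrite sumr_const -mulr_natr; lra.
apply: ler_sum => i iS; have it := St i iS.
under eq_bigr do rewrite mulr_sumr.
rewrite exchange_big /=.
under eq_bigr do rewrite bern_weight_pair.
have -> : #|S|%:R * t ^+ 2 + 1 = \sum_(k in S) (t ^+ 2 + (i == k)%:R).
  rewrite big_split /= sumr_const mulr_natl; congr (_ + _).
  rewrite (bigD1 i) //= eqxx big1 ?addr0 // => k /andP[_ /negbTE].
  by rewrite eq_sym => ->.
apply: ler_sum => k kS; have kt := St k kS; have /andP[li0 li1] := l01 i.
have /andP[lk0 _] := l01 k.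
case: eqVneq => _ /=; first by have := sqr_ge0 t; lra.
by rewrite addr0 expr2 ler_pM.
Qed.

End BernoulliMoment.

Definition clipped_average d n (r : R) (S : pred 'I_n) (z : n.-tuple (vec R d)) : vec R d :=
  [tuple #|S|%:R^-1 * \sum_(i in S) tnth (clip r (tnth z i)) j | j < d].

Lemma measurable_clipped_average d n r (S : pred 'I_n) :
  measurable_fun setT (@clipped_average d n r S).
Proof.
apply/measurable_fun_tnthP => j.
rewrite (_ : _ \o _ = fun z => #|S|%:R^-1 * \sum_i (i \in S)%:R * tnth (clip r (tnth z i)) j).
  apply: measurable_funM => //; apply: measurable_sum => i; apply: measurable_funM => //.
  have [mc _] := @bounded_mfun_clip d r j.
  exact: (measurableT_comp mc (measurable_tnth i)).
apply/funext => z /=; rewrite tnth_mktuple big_mkcond /=; congr (_ * _).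
by apply: eq_bigr => i _; case: (i \in S); rewrite ?mul1r ?mul0r.
Qed.

(** The error splits into the centred average of clean data and the mean displacement of
    contaminated points, and [(u + v) ^+ 2 <= 2 * u ^+ 2 + 2 * v ^+ 2]. The leading [0 +] is the
    offset of [iter_int_sqr_sum]. *)
Lemma clipped_average_error d n r (S : pred 'I_n) (mu : vec R d) x (b : n.-tuple bool) y :
  (0 < #|S|)%N ->
  sqnorm [tuple tnth (clipped_average r S (contaminate x b y)) j - tnth mu j | j < d] <=
  2 * (\sum_j (0 + \sum_i ((i \in S)%:R / #|S|%:R) * (tnth (clip r (tnth x i)) j - tnth mu j)) ^+ 2)
  + 8 * r ^+ 2 * (\sum_(i in S) (tnth b i)%:R) ^+ 2 / #|S|%:R ^+ 2.
Proof.
move=> S0; set N : R := #|S|%:R.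
have N0 : N != 0 by rewrite pnatr_eq0 -lt0n.
pose D i j := tnth (clip r (tnth y i)) j - tnth (clip r (tnth x i)) j.
pose w i : R := (i \in S)%:R * (tnth b i)%:R.
have w0 i : 0 <= w i by rewrite mulr_ge0.
have sumw : \sum_i w i = \sum_(i in S) (tnth b i)%:R.
  by rewrite [RHS]big_mkcond; apply: eq_bigr => i _; rewrite /w; case: ifP; rewrite ?mul1r ?mul0r.
have errE j : tnth (clipped_average r S (contaminate x b y)) j - tnth mu j =
    (0 + \sum_i ((i \in S)%:R / N) * (tnth (clip r (tnth x i)) j - tnth mu j)) +
    N^-1 * \sum_i w i * D i j.
  rewrite tnth_mktuple add0r.
  have {1}-> : tnth mu j = N^-1 * \sum_(i in S) tnth mu j.
    by rewrite sumr_const -mulr_natl mulKf.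
  rewrite -mulrBr -sumrB [X in _ * X = _]big_mkcond /= !mulr_sumr -big_split /=.
  apply: eq_bigr => i _; rewrite /w /D tnth_mktuple.
  by case: (i \in S) => /=; case: (tnth b i) => /=; ring.
rewrite /sqnorm.
apply: (@le_trans _ _ (\sum_j (2 * (0 + \sum_i ((i \in S)%:R / N) *
    (tnth (clip r (tnth x i)) j - tnth mu j)) ^+ 2 + 2 * (N^-1 * \sum_i w i * D i j) ^+ 2))).
  apply: ler_sum => j _; rewrite tnth_mktuple errE.
  set u := 0 + _; set v := N^-1 * _; have := sqr_ge0 (u - v); lra.
rewrite big_split /= -!mulr_sumr lerD2l -sumw.
under eq_bigr do rewrite exprMn.
rewrite -mulr_sumr.
(* Cauchy-Schwarz with weights [w], each displacement having squared norm at most [4 * r ^+ 2]. *)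
have : \sum_j (\sum_i w i * D i j) ^+ 2 <= 4 * r ^+ 2 * (\sum_i w i) ^+ 2.
  apply: (@le_trans _ _ (\sum_j (\sum_i w i) * \sum_i w i * D i j ^+ 2)).
    by apply: ler_sum => j _; exact: sqr_sum_le.
  rewrite -mulr_sumr exchange_big /= expr2 [leRHS]mulrCA ler_wpM2l ?sumr_ge0 // mulr_sumr.
  apply: ler_sum => i _; rewrite -mulr_sumr [leRHS]mulrC ler_wpM2l //.
  exact: clip_diff_le.
move=> H; have N2 : 0 <= 2 * N^-1 ^+ 2 by rewrite mulr_ge0 ?sqr_ge0.
apply: (@le_trans _ _ (2 * N^-1 ^+ 2 * (4 * r ^+ 2 * (\sum_i w i) ^+ 2))).
  by rewrite mulrA; exact: ler_wpM2l.
by rewrite exprVn; lra.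
Qed.

End ClippedAverage.

(** * Risk of the clipped average and the minimax upper bound *)

Section UpperBound.
Variable R : realType.

Lemma clipped_average_risk d (r : R) n (lam : 'I_n -> R) (t : R)
    (P : probability (vec R d) R) (A : adversary R d n) :
  (forall i, 0 <= lam i <= 1) -> 0 <= t <= 1 ->
  let S := [pred i | lam i <= t] in (0 < #|S|)%N -> ball_class r P ->
  (risk lam (clipped_average r S) P A <= (10 * r ^+ 2 * (#|S|%:R^-1 + t ^+ 2))%:E)%E.
Proof.
move=> l01 t01 S S0 Pr; set N : R := #|S|%:R.
have N0 : 0 < N by rewrite ltr0n.
pose Y j (x : vec R d) := tnth (clip r x) j - tnth (mean P) j.
have bY j : bounded_mfun (Y j).
  exact: (bounded_mfunD (bounded_mfun_clip r j) (bounded_mfun_cst _ _)).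
have EY j : Rintegral P setT (Y j) = 0.
  rewrite (_ : Y j = fun x => 1 * tnth (clip r x) j + - tnth (mean P) j).
    by rewrite expect_affine ?(mean_clip j Pr) ?mul1r ?subrr //; exact: bounded_mfun_clip.
  by apply/funext => x; rewrite mul1r.
pose K (b : n.-tuple bool) : R := \sum_(i in S) (tnth b i)%:R.
pose V := \sum_j Rintegral P setT (fun x => Y j x ^+ 2).
have V_le : V <= r ^+ 2 by exact: clip_second_moment.
have riskb b : (iter_int P (fun x => \int[A b x]_(y in setT)
    (sqnorm [tuple tnth (clipped_average r S (contaminate x b y)) j - tnth (mean P) j | j < d])%:E)
    <= (2 * r ^+ 2 / N + 8 * r ^+ 2 * K b ^+ 2 / N ^+ 2)%:E)%E.
  apply: (@le_trans _ _ (iter_int P (fun x => (2 * (\sum_j (0 + \sum_i ((i \in S)%:R / N) *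
      Y j (tnth x i)) ^+ 2) + 8 * r ^+ 2 * K b ^+ 2 / N ^+ 2)%:E))).
    apply: le_iter_int => x.
      by apply: integral_ge0 => y _; rewrite lee_fin sqnorm_ge0.
    (* The bound is free of the outliers and the kernel has mass one, so the adversary's integral
       disappears. *)
    set c := (X in (_ <= X)%E).
    have <- : (\int[A b x]_y cst c y = c)%E.
      rewrite integral_cst //; have /= -> := @prob_kernel _ _ _ _ _ (A b) x.
      by rewrite mule1.
    apply: le_integralT => y; first by rewrite lee_fin sqnorm_ge0.
    by rewrite lee_fin; exact: clipped_average_error.
  rewrite iter_int_sqr_sum // lee_fin lerD2r -mulrA ler_wpM2l //.
  rewrite big1 ?add0r => [|j _]; last by rewrite expr0n.
  have -> : \sum_i ((i \in S)%:R / N) ^+ 2 = N^-1.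
    transitivity (\sum_(i in S) N^-1 ^+ 2).
      rewrite [RHS]big_mkcond; apply: eq_bigr => i _.
      by case: (i \in S); rewrite ?mul1r // mul0r expr0n.
    by rewrite sumr_const -mulr_natl -/N; field; rewrite gt_eqF.
  by rewrite mulrC ler_wpM2r // invr_ge0 ltW.
apply: (@le_trans _ _ (\sum_(b : n.-tuple bool)
    (bern_weight lam b * (2 * r ^+ 2 / N + 8 * r ^+ 2 * K b ^+ 2 / N ^+ 2))%:E)%E).
  apply: lee_sum => b _; rewrite EFinM; apply: lee_wpmul2l (riskb b).
  by rewrite lee_fin bern_weight_ge0.
rewrite sumEFin lee_fin.
have -> : \sum_(b : n.-tuple bool)
    bern_weight lam b * (2 * r ^+ 2 / N + 8 * r ^+ 2 * K b ^+ 2 / N ^+ 2) =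
    2 * r ^+ 2 / N + 8 * r ^+ 2 / N ^+ 2 * \sum_(b : n.-tuple bool) bern_weight lam b * K b ^+ 2.
  rewrite -[in RHS](mul1r (2 * _ / N)) -(bern_weight_sum lam) mulr_suml mulr_sumr -big_split /=.
  by apply: eq_bigr => b _; ring.
have c0 : 0 <= 8 * r ^+ 2 / N ^+ 2 by rewrite divr_ge0 ?sqr_ge0 // mulr_ge0 ?sqr_ge0.
have /andP[_ t1] := t01.
have := ler_wpM2l c0 (bern_sum_sqr_le (S := S) t1 l01 _); rewrite -/N => /(_ (fun i iS => iS)) H.
rewrite (le_trans (lerD (lexx _) H)) //.
have -> : 8 * r ^+ 2 / N ^+ 2 * (N ^+ 2 * t ^+ 2 + N) = 8 * r ^+ 2 * (t ^+ 2 + N^-1).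
  by field; rewrite gt_eqF.
(* The total is [10 * r ^+ 2 / N + 8 * r ^+ 2 * t ^+ 2], whence the constant [10]. *)
have : 0 <= r ^+ 2 * t ^+ 2 by rewrite mulr_ge0 ?sqr_ge0.
lra.
Qed.

Lemma minimax_upper_bound d (r : R) n (lam : 'I_n -> R) :
  0 < r -> (forall i, 0 <= lam i <= 1) ->
  (@minimax_rate R d n lam r <= (10 * r ^+ 2)%:E * frate lam 1)%E.
Proof.
move=> r0 l01; have c0 : 0 < 10 * r ^+ 2 by rewrite mulr_gt0 // exprn_gt0.
rewrite /frate -ereal_inf_pZl //; apply/ereal_infP => _ [_ [t /= t01 <-] <-].
rewrite in_itv /= in t01.
(* When no index has [lam i <= t], the value at [t] is [+oo] and the bound is trivial. *)
rewrite /fval card_set_bool; case: eqP => [_|/eqP S0].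
  by rewrite addye // gt0_muley ?lte_fin // leey.
apply: (@le_trans _ _ (ereal_sup [set risk lam
   (clipped_average r [pred i | lam i <= t]) P A | P in @ball_class R d r & A in setT])).
  apply: ereal_inf_lbound; eexists; last reflexivity.
  exact: measurable_clipped_average.
apply/ereal_supP => _ [P Pr [A _ <-]].
by rewrite -EFinD -EFinM mul1r; apply: clipped_average_risk; rewrite ?lt0n.
Qed.

End UpperBound.

Theorem theorem1 (R : realType) :
  exists c1 c2 : R, 0 < c1 /\ c1 <= c2 /\
    forall (d : nat) (r : R) (n : nat) (lam : 'I_n -> R),
      (1 <= d)%N -> 0 < r -> (1 <= n)%N ->
      (forall i, 0 <= lam i <= 1) ->
      (((c1 * r ^+ 2)%:E * frate lam 1) <= minimax_rate d lam r /\
       minimax_rate d lam r <= (c2 * r ^+ 2)%:E * frate lam 1)%E.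
Proof.
exists 80^-1, 10; split; first by rewrite invr_gt0.
split; first by lra.
move=> [//|d] r n lam _ r0 n1 l01; split; first exact: minimax_lower_bound (ltW r0) l01.
exact: minimax_upper_bound.
Qed.
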